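(* Let $p$ be a prime number and let $M$ be a $p$-minor subset. Then $\mathcal{C}(M)$ is a linearly closed iterative algebra on $\mathbb{Z}_p$ if and only if $M\subseteq\{0,1\}$, or $M=\mathbb{N}_0$, or $M=\{1+tm\mid t\in\mathbb{N}_0\}$ for some $m\in\mathbb{N}$ with $m\mid p-1$.
   Context: $\mathbb{N}=\{1,2,3,\dots\}$, $\mathbb{N}_0=\mathbb{N}\cup\{0\}$. A set $M\subseteq\mathbb{N}_0$ is a $p$-minor subset if $n-(p-1)\in M$ for all $n\in M$ with $n>p-1$. All operations considered have arity $n\ge1$. For sets $E,F$ of finitary operations on $\mathbb{Z}_p$, $EF:=\{f(g_1,\dots,g_n)\mid n,m\in\mathbb{N},\ f\in E \text{ } n\text{-ary},\ g_1,\dots,g_n\in F\text{ } m\text{-ary}\}$. $\mathcal{L}_{\mathbb{Z}_p}$ is the clone on $\mathbb{Z}_p$ generated by $+$, and $J_{\mathbb{Z}_p}$ is the set of all projections $\pi^n_j(x_1,\dots,x_n)=x_j$, $1\le j\le n$. A nonempty set $C$ of finitary operations on $\mathbb{Z}_p$ is a linearly closed clonoid on $\mathbb{Z}_p$ if $\mathcal{L}_{\mathbb{Z}_p}C\subseteq C$ and $C\mathcal{L}_{\mathbb{Z}_p}\subseteq C$. It is a linearly closed iterative algebra on $\mathbb{Z}_p$ if moreover $C(C\cup J_{\mathbb{Z}_p})\subseteq C$. Let $\mathbb{Z}_p[X]$ be the polynomial ring over $\mathbb{Z}_p$ in the variables $x_1,x_2,\dots$. $\mathbb{Z}_p^*[X]$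 is the set of reduced polynomials: those in which every variable occurs with exponent at most $p-1$ in every monomial. For $f\in\mathbb{Z}_p[X]$, $\operatorname{TD}(f)$ is the set of total degrees of the monomials occurring in $f$ with nonzero coefficient ($\operatorname{TD}(0)=\emptyset$), $\operatorname{mI}(f)$ is the largest index $i$ such that $x_i$ occurs in $f$ (and $0$ if no variable occurs), and for $n\ge\operatorname{mI}(f)$, $n\geq 1$, $f^{\mathbb{Z}_p^n}:\mathbb{Z}_p^n\to\mathbb{Z}_p$ is the function induced by $f$. For a $p$-minor subset $M$, $$\mathcal{C}(M):=\{0^{\mathbb{Z}_p^n}\mid n\in\mathbb{N}\}\cup\{f^{\mathbb{Z}_p^n}\mid f\in\mathbb{Z}_p^*[X],\ n\ge\max(1,\operatorname{mI}(f)),\ \operatorname{TD}(f)\subseteq M\}.$$ *)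

(* Defs.v *)
From mathcomp Require Import all_boot all_algebra finmap.
From mathcomp.multinomials Require Import monalg.

Set Implicit Arguments.
Unset Strict Implicit.
Unset Printing Implicit Defensive.

Import GRing.Theory.
Local Open Scope ring_scope.

Section Operations.
Variable A : finType.

Definition op (n : nat) : Type := {ffun {ffun 'I_n -> A} -> A}.

(* The component of index n holds the members of arity n.+1, so every
   operation in an opset has positive arity. *)
Definition opset : Type := forall n : nat, op n.+1 -> Prop.

Definition opsub (E F : opset) : Prop := forall n (f : op n.+1), E n f -> F n f.

Definition opcup (E F : opset) : opset := fun n f => E n f \/ F n f.

Definition opcomp n m (f : op n) (g : 'I_n -> op m) : op m :=
  [ffun v : {ffun 'I_m -> A} => f [ffun i => g i v]].

Definition opprod (E F : opset) : opset := fun m h =>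
  exists (n : nat) (f : op n.+1) (g : 'I_n.+1 -> op m.+1),
    [/\ E n f, forall i, F m (g i) & h = opcomp f g].

Definition proj n (j : 'I_n) : op n := [ffun v : {ffun 'I_n -> A} => v j].

Definition projections : opset := fun n f => exists j : 'I_n.+1, f = proj j.

Definition is_clone (C : opset) : Prop :=
  opsub projections C /\ opsub (opprod C C) C.

Definition clone_generated (E : opset) : opset := fun n f =>
  forall C : opset, is_clone C -> opsub E C -> C n f.

End Operations.

Section LinearlyClosed.
Variable p : nat.

Definition addop : op 'F_p 2 :=
  [ffun v : {ffun 'I_2 -> 'F_p} => v ord0 + v ord_max].

Variant addition : forall n, op 'F_p n.+1 -> Prop :=
  Addition : @addition 1 addop.

Definition lin_clone : opset 'F_p := clone_generated addition.

Definition lin_closed_clonoid (C : opset 'F_p) : Prop :=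
  [/\ exists n (f : op 'F_p n.+1), C n f,
      opsub (opprod lin_clone C) C
    & opsub (opprod C lin_clone) C].

Definition lin_closed_iterative_algebra (C : opset 'F_p) : Prop :=
  lin_closed_clonoid C /\
  opsub (opprod C (opcup C (@projections 'F_p))) C.

End LinearlyClosed.

Section Polynomials.
Variable p : nat.

(* Indices start at 0: the exponent m i of a monomial m is that of x_(i+1). *)
Definition infpoly : Type := {malg 'F_p[{cmonom nat}]}.

Implicit Types (f : infpoly) (M : nat -> Prop).

Definition reduced f : Prop :=
  forall m, m \in msupp f -> forall i, (m i <= p.-1)%N.

Definition TD f : nat -> Prop := fun d => exists2 m, m \in msupp f & mdeg m = d.

Definition mI f : nat :=
  (\max_(m <- msupp f) \max_(i <- finsupp m) i.+1)%N.

(* Only used at indices i < n when n >= mI f. *)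
Definition point n (v : {ffun 'I_n -> 'F_p}) (i : nat) : 'F_p :=
  if insub i is Some j then v j else 0.

Definition induced n f : op 'F_p n :=
  [ffun v : {ffun 'I_n -> 'F_p} =>
     mmap idfun (fun m : {cmonom nat} =>
                   \prod_(i <- finsupp m) point v i ^+ m i) f].

Definition minor_subset M : Prop :=
  forall n, M n -> (p.-1 < n)%N -> M (n - p.-1)%N.

Definition clonoid_of M : opset 'F_p := fun n F =>
  F = [ffun=> 0] \/
  exists f, [/\ reduced f, (maxn 1 (mI f) <= n.+1)%N,
                forall d, TD f d -> M d & F = induced n.+1 f].

End Polynomials.

(* Main.v *)
From Stdlib Require Import Classical.
Require Import Defs.
From mathcomp Require Import all_boot all_algebra finmap zify.
From mathcomp.multinomials Require Import monalg.
From mathcomp Require Import finfield.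
Import GRing.Theory.

(** Both sides of the equivalence are matched with one arithmetic condition on
    [M], that it is [insertion_closed]: replacing one of [a > 0] factors of
    degree 1 by a factor of degree [b] turns a product of degree [a] into one
    of degree [a.-1 + b].

    Since [x ^ p = x] on the field, lowering an exponent above [p.-1] by [p.-1]
    does not change a monomial function, and a minor subset is stable under the
    corresponding drop of the degree. So for minor [M] the clonoid is simply
    the span of all monomial functions, reduced or not, of degree in [M]
    ([clonoid_of_degspan]). Spans behave well under composition: substituting
    members of the span of degrees [E] into a monomial of degree [d] yields
    monomials whose degree is a sum of [d] elements of [E] ([degspan_comp]).
    When [M] is insertion closed, such sums with [d] in [M] and [E] made of [M]
    and 1 stay in [M], because the [d] ones can be replaced one at a time
    ([insertion_closed_sum]); this gives all the closure properties at once,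
    the operations generated by addition being spanned by degree 1.

    Conversely, if the clonoid is closed under composition, then substituting
    [x_a ... x_(a+b-1)] for the last variable of [x_1 ... x_a] shows that the
    product of [a.-1 + b] distinct variables belongs to it. The degree of that
    product can be read off from the function: a weighted sum over all points
    extracts the coefficient of the multilinear monomial from any reduced
    polynomial ([multilinear_degree]). Hence [M] is insertion closed
    ([insertion_closed_composition]).

    It remains to classify the insertion closed minor subsets [M] having an
    element [n > 1] ([insertion_closedP]). If 0 is in [M], inserting 0 brings
    [n] down to 2, and inserting into 2 then climbs through all naturals. If
    not, the predecessors of the elements of [M] form an additive semigroup
    stable under subtraction of [p.-1], and such a semigroup is the set of
    multiples of a divisor of [p.-1]
    ([subtractive_semigroup_multiples]). *)

(** * Insertion closed sets of degrees *)

Definition insertion_closed (M : nat -> Prop) : Prop :=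
  forall a b, 0 < a -> M a -> M b -> M (a.-1 + b).

Lemma least_positive (S : nat -> Prop) (s : nat) :
  0 < s -> S s -> exists m, [/\ 0 < m, S m & forall k, 0 < k -> S k -> m <= k].
Proof.
elim/ltn_ind: s => s IH s_gt0 Ss.
case: (classic (exists k, [/\ 0 < k, k < s & S k])) => [[k [k0 ks Sk]]|no].
  exact: IH ks k0 Sk.
exists s; split=> // k k0 Sk; rewrite leqNgt; apply/negP => ks.
by apply: no; exists k.
Qed.

(** Modulo [q] the semigroup is a finite group, so subtraction is available in
    it: adding [q.-1] copies of an element and removing multiples of [q]
    amounts to subtracting that element. Euclidean division by the least
    positive member then applies. *)
Lemma subtractive_semigroup_multiples (S : nat -> Prop) (q s : nat) :
    0 < q -> (forall a b, S a -> S b -> S (a + b)) ->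
    (forall a, S a -> q <= a -> S (a - q)) -> 0 < s -> S s ->
  exists m, [/\ 0 < m, m %| q & forall n, S n <-> m %| n].
Proof.
move=> q_gt0 SD Sq s_gt0 Ss.
have SqM k a : S (a + k * q) -> S a.
  elim: k => [|k IH]; first by rewrite mul0n addn0.
  move=> /Sq; rewrite mulSn addnCA leq_addr addKn => /(_ isT); exact: IH.
have SM k a : S a -> S (k.+1 * a).
  by move=> Sa; elim: k => [|k IH]; rewrite ?mul1n // mulSn; apply: SD.
have S0 : S 0.
  by apply: (SqM s); rewrite add0n mulnC -(prednK q_gt0); apply: SM.
have Sq' : S q.
  apply: (SqM s.-1); rewrite -mulSn prednK // mulnC -(prednK q_gt0).
  exact: SM.
have [m [m_gt0 Sm m_min]] := least_positive S s s_gt0 Ss.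
have Smul n : m %| n -> S n.
  by case/dvdnP=> -[|k] ->; [rewrite mul0n | apply: SM].
have Sdvd n : S n -> m %| n.
  move=> Sn; rewrite /dvdn; apply: contraT; rewrite -lt0n => r_gt0.
  suff /m_min : S (n %% m) by rewrite r_gt0 leqNgt ltn_pmod // => /(_ isT).
  (* Adding q - 1 times (n / m) m to n gives n mod m plus a multiple of q. *)
  apply: (SqM (n %/ m * m)).
  have -> : n %% m + n %/ m * m * q = n + n %/ m * m * q.-1.
    by rewrite {3}(divn_eq n m); nia.
  by apply: SD => //; apply: Smul; rewrite mulnAC dvdn_mull.
by exists m; split; [|apply: Sdvd|move=> n; split; [apply: Sdvd|apply: Smul]].
Qed.

(** The interesting direction compares [M] with the set of predecessors of its
    elements: [a.+1] and [b.+1] in [M] give [a + b.+1] in [M], so that insertion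
    becomes addition. *)
Lemma insertion_closedP (p : nat) (M : nat -> Prop) :
    0 < p.-1 -> minor_subset p M ->
  insertion_closed M <->
  (forall n, M n -> n = 0 \/ n = 1) \/ (forall n, M n) \/
  (exists m, [/\ 0 < m, m %| p.-1 & forall n, M n <-> exists t, n = 1 + t * m]).
Proof.
move=> q_gt0 Mminor; split=> [insM|]; last first.
  move=> [M01|[Mall|[m [_ _ Mm]]]] a b a_gt0 Ma Mb; last 2 first.
  - exact: Mall.
  - move/Mm: Ma => [t ->]; move/Mm: Mb => [u ->]; apply/Mm.
    by exists (t + u); rewrite mulnDl; lia.
  by have [a0|a1] := M01 a Ma; [rewrite a0 in a_gt0 | rewrite a1].
have [|M01] := classic (forall n, M n -> n = 0 \/ n = 1); first by left.
have {M01} [n [Mn n_gt1]] : exists n, M n /\ 1 < n.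
  apply: NNPP => no; apply: M01 => -[|[|n]] Mn; [by left|by right|].
  by case: no; exists n.+2.
right; case: (classic (M 0)) => [M0|nM0]; [left|right].
  have Mle k : k <= n -> M (n - k).
    elim: k => [|k IH] kn; first by rewrite subn0.
    have := insM _ _ _ (IH (ltnW kn)) M0.
    by rewrite addn0 subnS subn_gt0; apply.
  have M2 : M 2 by have := Mle _ (leq_subr 2 n); rewrite subKn.
  elim=> // k Mk; exact: insM 2 k _ M2 Mk.
have [||||m [m_gt0 mq Sm]] :=
    subtractive_semigroup_multiples (fun k => M k.+1) p.-1 n.-1 q_gt0.
- by move=> a b /insM/[apply]/(_ isT); rewrite /= addnS.
- by move=> a /Mminor; rewrite ltnS => sub qa; rewrite -subSn //; apply: sub.
- by rewrite -subn1 subn_gt0.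
- by rewrite prednK // ltnW.
exists m; split=> // -[|k]; split.
- by move/nM0.
- by case=> t; rewrite add1n.
- by case/Sm/dvdnP=> t ->; exists t; rewrite add1n.
- by case=> t; rewrite add1n => -[->]; apply/Sm/dvdn_mull.
Qed.

(** * Spans of monomial functions *)

Section MonomialSpans.
Local Open Scope ring_scope.
Variable p : nat.

Definition monf n (e : 'I_n -> nat) : op 'F_p n :=
  [ffun v : {ffun 'I_n -> 'F_p} => \prod_i v i ^+ e i].

(** The condition bears on exponent vectors, not only on degrees, so that the
    same notion serves for reduced monomials and for monomials of given
    degrees. *)
Inductive mspan n (P : ('I_n -> nat) -> Prop) : op 'F_p n -> Prop :=
| mspan0 : mspan n P [ffun=> 0]
| mspanD c e F : P e -> mspan n P F ->
    mspan n P [ffun v => c * monf n e v + F v].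

Arguments monf {n} e.
Arguments mspan {n} P _.
Arguments mspanD {n P} c {e F}.

Definition degspan (D : nat -> Prop) : opset 'F_p :=
  fun n => mspan (fun e : 'I_n.+1 -> nat => D (\sum_i e i)%N).

Lemma mspanS n (P Q : ('I_n -> nat) -> Prop) F :
  (forall e, P e -> Q e) -> mspan P F -> mspan Q F.
Proof.
move=> PQ; elim=> [|c e G Pe _]; [exact: mspan0 | exact: mspanD (PQ _ Pe)].
Qed.

Lemma mspan_add n (P : ('I_n -> nat) -> Prop) F G :
  mspan P F -> mspan P G -> mspan P [ffun v => F v + G v].
Proof.
move=> PF PG; elim: PF => [|c e H Pe _ IH].
  by have -> : [ffun v => [ffun=> 0] v + G v] = G
    by apply/ffunP => v; rewrite !ffunE add0r.
have -> : [ffun v => [ffun v => c * monf e v + H v] v + G v]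
        = [ffun v => c * monf e v + [ffun v => H v + G v] v].
  by apply/ffunP => v; rewrite !ffunE addrA.
exact: mspanD.
Qed.

Lemma mspan_scale_mon n (P : ('I_n -> nat) -> Prop) c e :
  P e -> mspan P [ffun v => c * monf e v].
Proof.
move=> Pe; have -> : [ffun v => c * monf e v]
                   = [ffun v => c * monf e v + [ffun=> 0] v].
  by apply/ffunP => v; rewrite !ffunE addr0.
by apply: mspanD => //; apply: mspan0.
Qed.

Lemma mspan_mon n (P : ('I_n -> nat) -> Prop) e : P e -> mspan P (monf e).
Proof.
move=> /(mspan_scale_mon _ _ 1); congr mspan.
by apply/ffunP => v; rewrite ffunE mul1r.
Qed.

Lemma mspan_sum n (P : ('I_n -> nat) -> Prop) (I : eqType) (r : seq I)
    (c : I -> 'F_p) (e : I -> 'I_n -> nat) :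
    {in r, forall x, P (e x)} ->
  mspan P [ffun v => \sum_(x <- r) c x * monf (e x) v].
Proof.
elim: r => [|x r IH] Pe.
  by move: (mspan0 n P); congr mspan; apply/ffunP => v; rewrite !ffunE big_nil.
have -> : [ffun v => \sum_(y <- x :: r) c y * monf (e y) v]
  = [ffun v => c x * monf (e x) v
               + [ffun v => \sum_(y <- r) c y * monf (e y) v] v].
  by apply/ffunP => v; rewrite !ffunE big_cons ffunE.
apply: mspanD; first by apply: Pe; rewrite mem_head.
by apply: IH => y ry; apply: Pe; rewrite inE ry orbT.
Qed.

Lemma mspan_mul n (P Q R : ('I_n -> nat) -> Prop) F G :
    (forall d e, P d -> Q e -> R (fun i => d i + e i)%N) ->
  mspan P F -> mspan Q G -> mspan R [ffun v => F v * G v].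
Proof.
move=> PQR PF QG; elim: PF => [|c d H Pd _ IH].
  by move: (mspan0 n R); congr mspan; apply/ffunP => v; rewrite !ffunE mul0r.
have -> : [ffun v => [ffun v => c * monf d v + H v] v * G v]
  = [ffun v => [ffun v => c * monf d v * G v] v + [ffun v => H v * G v] v].
  by apply/ffunP => v; rewrite !ffunE mulrDl.
apply: mspan_add IH; elim: QG => [|c' e K Qe _ IH].
  by move: (mspan0 n R); congr mspan; apply/ffunP => v; rewrite !ffunE mulr0.
have -> : [ffun v => c * monf d v * [ffun v => c' * monf e v + K v] v]
  = [ffun v => c * c' * monf (fun i => d i + e i)%N v
               + [ffun v => c * monf d v * K v] v].
  apply/ffunP => v; rewrite !ffunE mulrDr; congr (_ + _).
  rewrite mulrACA -big_split /=; congr (_ * _).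
  by apply: eq_bigr => i _; rewrite exprD.
by apply: mspanD IH; apply: PQR.
Qed.

Definition sum_of (E : nat -> Prop) (d n : nat) : Prop :=
  exists s : seq nat, [/\ size s = d, forall x, x \in s -> E x & n = sumn s].

Lemma sum_of0 E : sum_of E 0 0. Proof. by exists [::]. Qed.

Lemma sum_ofD E d1 d2 n1 n2 :
  sum_of E d1 n1 -> sum_of E d2 n2 -> sum_of E (d1 + d2) (n1 + n2).
Proof.
move=> [s1 [<- E1 ->]] [s2 [<- E2 ->]]; exists (s1 ++ s2).
rewrite size_cat sumn_cat; split=> // x.
by rewrite mem_cat => /orP[/E1|/E2].
Qed.

Lemma sum_of1 (E : nat -> Prop) n : sum_of E 1 n <-> E n.
Proof.
split=> [[s [s_1 Es ->]]|En].
  by case: s s_1 Es => [|x []] // _ Es; rewrite /= addn0; apply/Es/mem_head.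
by exists [:: n]; rewrite /= addn0; split=> // x; rewrite inE => /eqP->.
Qed.

Lemma degspan_mul D1 D2 D n (F G : op 'F_p n.+1) :
    (forall d1 d2, D1 d1 -> D2 d2 -> D (d1 + d2)%N) ->
  degspan D1 n F -> degspan D2 n G -> degspan D n [ffun v => F v * G v].
Proof. by move=> DD; apply: mspan_mul => d e; rewrite big_split; apply: DD. Qed.

(** A product of powers is expanded one factor at a time, each factor adding
    one element of [E] to the degree. *)
Lemma degspan_prod E n (I : Type) (r : seq I) (e : I -> nat)
    (g : I -> op 'F_p n.+1) :
    (forall i, degspan E n (g i)) ->
  degspan (sum_of E (\sum_(i <- r) e i)) n
          [ffun v => \prod_(i <- r) g i v ^+ e i].
Proof.
move=> Eg.
have one : degspan (sum_of E 0) n [ffun=> 1].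
  have <- : monf (fun=> 0%N) = [ffun=> 1] :> op 'F_p n.+1.
    by apply/ffunP => v; rewrite !ffunE big1.
  by apply: mspan_mon; rewrite big1 //; apply: sum_of0.
have power i k : degspan (sum_of E k) n [ffun v => g i v ^+ k].
  elim: k => [|k IH].
    by move: one; congr degspan; apply/ffunP => v; rewrite !ffunE.
  have -> : [ffun v => g i v ^+ k.+1]
          = [ffun v => g i v * [ffun v => g i v ^+ k] v].
    by apply/ffunP => v; rewrite !ffunE exprS.
  by apply: degspan_mul (Eg i) IH => d1 d2 /sum_of1; apply: sum_ofD.
elim: r => [|i r IH].
  rewrite big_nil; move: one; congr degspan.
  by apply/ffunP => v; rewrite !ffunE big_nil.
have -> : [ffun v => \prod_(j <- i :: r) g j v ^+ e j]
  = [ffun v => [ffun v => g i v ^+ e i] v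
               * [ffun v => \prod_(j <- r) g j v ^+ e j] v].
  by apply/ffunP => v; rewrite !ffunE big_cons.
rewrite big_cons; apply: degspan_mul (power i _) IH => d1 d2; exact: sum_ofD.
Qed.

(** This single lemma provides every closure property of the clonoids: left
    and right multiplication by linear operations, and iteration, only differ
    in the choice of [D] and [E]. *)
Lemma degspan_comp (D E M : nat -> Prop) :
    (forall d n, D d -> sum_of E d n -> M n) ->
  opsub (opprod (degspan D) (degspan E)) (degspan M).
Proof.
move=> DEM m h [n [f [g [Df Eg ->]]]].
elim: Df => [|c e F De _ IH].
  by move: (mspan0 _ (fun e : 'I_m.+1 -> nat => M (\sum_i e i)%N)); congr mspan;
    apply/ffunP => v; rewrite !ffunE.
have -> : opcomp [ffun v => c * monf e v + F v] g
  = [ffun v => [ffun v => [ffun=> c] v * [ffun v => \prod_i g i v ^+ e i] v] v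
               + opcomp F g v].
  apply/ffunP => v; rewrite !ffunE; congr (_ * _ + _).
  by apply: eq_bigr => i _; rewrite ffunE.
apply: mspan_add IH.
have const : degspan (eq 0%N) m [ffun=> c].
  have -> : [ffun=> c] = [ffun v => c * monf (fun=> 0%N) v] :> op _ m.+1.
    by apply/ffunP => v; rewrite !ffunE big1 ?mulr1.
  by apply: mspan_scale_mon; rewrite big1.
apply: degspan_mul const (degspan_prod _ _ _ _ _ _ Eg) => _ k <-; exact: DEM.
Qed.

Lemma projE n (j : 'I_n) : proj 'F_p j = monf (fun i => (i == j) : nat).
Proof.
apply/ffunP => v; rewrite !ffunE (bigD1 j) //= eqxx big1 ?mulr1 // => i.
by move=> /negPf->.
Qed.

Lemma sum_pick n (j : 'I_n) : (\sum_i (i == j) = 1)%N.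
Proof. by rewrite (bigD1 j) //= eqxx big1 // => i /negPf->. Qed.

Lemma projections_linear : opsub (@projections 'F_p) (degspan (eq 1%N)).
Proof.
by move=> n _ [j ->]; rewrite projE; apply: mspan_mon; rewrite sum_pick.
Qed.

(** The span of the monomials of degree 1 is itself a clone containing the
    addition, hence it contains the clone that addition generates. *)
Lemma lin_clone_linear : opsub (@lin_clone p) (degspan (eq 1%N)).
Proof.
move=> n f; apply; last first.
  move=> _ _ [].
  have -> : addop p = [ffun v => proj 'F_p ord0 v + proj 'F_p ord_max v].
    by apply/ffunP => v; rewrite !ffunE.
  by apply: mspan_add; apply: (projections_linear 1); eexists.
split; first exact: projections_linear.
by apply: degspan_comp => _ k <- /sum_of1.
Qed.

(** * From polynomials to spans of monomial functions *)

Lemma big_finsupp_ord (R : Type) (idx : R) (o : Monoid.com_law idx) (n : nat)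
    (m : {cmonom nat}) (G : nat -> R) :
    (forall i, i \in finsupp m -> (i < n)%N) ->
    (forall i, i \notin finsupp m -> G i = idx) ->
  \big[o/idx]_(i <- finsupp m) G i = \big[o/idx]_(i < n) G i.
Proof.
move=> m_lt G_idx; rewrite -(big_mkord xpredT G) /=.
rewrite [RHS](bigID (mem (finsupp m))) /=.
rewrite [X in o _ X]big1 ?Monoid.mulm1; last by move=> i /G_idx.
rewrite -[RHS]big_filter; apply: perm_big; apply: uniq_perm.
- exact: fset_uniq.
- by rewrite filter_uniq ?iota_uniq.
move=> i; rewrite mem_filter mem_index_iota /=.
by case: (boolP (i \in _)) => // /m_lt ->.
Qed.

Definition admissible_monomial n (M : nat -> Prop) (m : {cmonom nat}) : Prop :=
  [/\ forall i, (m i <= p.-1)%N, forall i, i \in finsupp m -> (i < n)%N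
    & M (mdeg m)].

Lemma point_ord n (v : {ffun 'I_n -> 'F_p}) (i : 'I_n) : point v i = v i.
Proof. by rewrite /point valK. Qed.

Lemma prod_point n (m : {cmonom nat}) (v : {ffun 'I_n -> 'F_p}) :
    (forall i, i \in finsupp m -> (i < n)%N) ->
  \prod_(i <- finsupp m) point v i ^+ m i = monf (fun i : 'I_n => m i) v.
Proof.
move=> m_lt; rewrite ffunE (big_finsupp_ord _ _ _ n) //=.
  by apply: eq_bigr => i _; rewrite point_ord.
by move=> i /fsfun_dflt ->.
Qed.

Lemma mdeg_ord n (m : {cmonom nat}) :
  (forall i, i \in finsupp m -> (i < n)%N) -> mdeg m = (\sum_(i < n) m i)%N.
Proof.
by move=> m_lt; apply: big_finsupp_ord => // i /fsfun_dflt ->.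
Qed.

Lemma leq_mI (f : infpoly p) n :
  (mI f <= n)%N <->
  (forall m, m \in msupp f -> forall i, i \in finsupp m -> (i < n)%N).
Proof.
rewrite /mI; split.
  move/bigmax_leqP_seq => H m mf i im.
  by move/bigmax_leqP_seq: (H m mf isT) => /(_ i im isT).
move=> H; apply/bigmax_leqP_seq => m mf _.
by apply/bigmax_leqP_seq => i im _; apply: H im.
Qed.

(** The zero operation, listed separately in the clonoid, is induced by the
    zero polynomial. *)
Lemma clonoid_ofE M n (F : op 'F_p n.+1) :
  clonoid_of M F <-> exists f : infpoly p,
    (forall m, m \in msupp f -> admissible_monomial n.+1 M m)
    /\ F = induced n.+1 f.
Proof.
split=> [[->|[f [f_red f_mI f_TD ->]]]|[f [f_good ->]]].
- exists 0; split; first by move=> m; rewrite msupp0.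
  by apply/ffunP => v; rewrite !ffunE /mmap msupp0 big_seq_fset0.
- exists f; split=> // m mf; split; first exact: f_red.
    by apply: (leq_mI f _).1 mf; rewrite (leq_trans _ f_mI) // leq_maxr.
  by apply: f_TD; exists m.
right; exists f; split=> //.
- by move=> m /f_good[].
- by rewrite geq_max /=; apply/leq_mI => m /f_good[].
- by move=> d [m /f_good[_ _ Mm] <-].
Qed.

Definition cmonom_of_exps n (e : 'I_n -> nat) : {cmonom nat} :=
  mkcmonom [fsfun i in [fset i | i in iota 0 n]%fset =>
              if insub i is Some j then e j else 0%N | 0%N].

Lemma cmonom_of_exps_ord n (e : 'I_n -> nat) (i : 'I_n) :
  cmonom_of_exps n e i = e i.
Proof.
rewrite /cmonom_of_exps cmE fsfun_fun valK.
by rewrite in_fset /= mem_iota ltn_ord.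
Qed.

Lemma cmonom_of_exps_supp n (e : 'I_n -> nat) i :
  i \in finsupp (cmonom_of_exps n e) -> (i < n)%N.
Proof.
rewrite -cmE_neq0 /cmonom_of_exps cmE fsfun_fun in_fset /= mem_iota add0n.
by case: ltnP => //.
Qed.

Lemma clonoid_of_mspan M n (F : op 'F_p n.+1) :
  clonoid_of M F <->
  mspan (fun e : 'I_n.+1 -> nat =>
           (forall i, (e i <= p.-1)%N) /\ M (\sum_i e i)%N) F.
Proof.
split=> [/clonoid_ofE[f [f_good ->]]|].
  have -> : induced n.+1 f = [ffun v => \sum_(m <- msupp f)
                   f@_m * monf (fun i : 'I_n.+1 => m i) v].
    apply/ffunP => v; rewrite !ffunE /mmap big_seq [RHS]big_seq.
    by apply: eq_bigr => m /f_good[_ m_lt _]; rewrite prod_point.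
  apply: mspan_sum => m /f_good[m_red m_lt Mm]; split=> //.
  by rewrite -mdeg_ord.
elim=> [|c e G [e_red Me] _ /clonoid_ofE[f [f_good ->]]]; first by left.
pose m := cmonom_of_exps _ e.
have m_lt : forall i, i \in finsupp m -> (i < n.+1)%N.
  exact: cmonom_of_exps_supp.
apply/clonoid_ofE; exists (<< c *g m >> + f); split.
  move=> k /(fsubsetP (msuppD_le _ _)); rewrite in_fsetU => /orP[|/f_good//].
  move/(fsubsetP msuppU_le); rewrite in_fset1 => /eqP->.
  split=> // [i|].
    case: (boolP (i \in finsupp m)) => [/m_lt i_lt|/fsfun_dflt -> //].
    by rewrite (cmonom_of_exps_ord _ e (Ordinal i_lt)).
  rewrite (mdeg_ord n.+1) //.
  suff -> : (\sum_(i < n.+1) m i = \sum_i e i)%N by [].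
  by apply: eq_bigr => i _; rewrite cmonom_of_exps_ord.
apply/ffunP => v; rewrite !ffunE mmapD mmapU prod_point // !ffunE.
by congr (_ * _ + _); apply: eq_bigr => i _; rewrite cmonom_of_exps_ord.
Qed.

Section PrimeField.
Hypothesis p_prime : prime p.

(** Fermat's little theorem allows replacing an exponent [k >= p] by
    [k - p.-1], which is still positive; the total degree exceeds [p.-1], so
    the minor condition keeps the new degree in [M]. *)
Lemma monf_reduce M n (e : 'I_n -> nat) :
    minor_subset p M -> M (\sum_i e i)%N ->
  exists d : 'I_n -> nat, [/\ forall i, (d i <= p.-1)%N, M (\sum_i d i)%N
                            & monf d = monf e].
Proof.
move=> M_minor; have [k] := ubnP (\sum_i e i)%N.
elim: k e => // k IH e; rewrite ltnS => e_k Me.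
have p_gt1 := prime_gt1 p_prime.
have [/existsP[j]|/existsPn no] := boolP [exists j, (p.-1 < e j)%N]; last first.
  by exists e; split=> // i; rewrite leqNgt no.
rewrite prednK ?ltnS ?prime_gt0 // => ej.
pose d i := if i == j then (e i - p.-1)%N else e i.
have sum_d : (\sum_i d i = \sum_i e i - p.-1)%N.
  rewrite (bigD1 j) //= [in RHS](bigD1 j) //= /d eqxx -addnBAC; last by lia.
  by congr (_ + _)%N; apply: eq_bigr => i /negPf->.
have ej_le : (e j <= \sum_i e i)%N by rewrite (bigD1 j) //= leq_addr.
have [||d' [d'_red Md' d'_d]] := IH d.
- by rewrite sum_d; lia.
- by rewrite sum_d; apply: M_minor => //; lia.
exists d'; split=> //; rewrite d'_d; apply/ffunP => v; rewrite !ffunE.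
apply: eq_bigr => i _; rewrite /d; case: eqP => // ->.
have -> : (e j = (e j - p) + p)%N by rewrite subnK.
have -> : (e j - p + p - p.-1 = (e j - p).+1)%N by lia.
have fermat : v j ^+ p = v j by rewrite -{2}[v j]expf_card card_Fp.
by rewrite exprD fermat exprSr.
Qed.

Lemma clonoid_of_degspan M n (F : op 'F_p n.+1) : minor_subset p M ->
  clonoid_of M F <-> degspan M n F.
Proof.
move=> M_minor; split=> [/clonoid_of_mspan|MF].
  by apply: mspanS => e [].
apply/clonoid_of_mspan; elim: MF => [|c e G Me _]; first exact: mspan0.
have [d [d_red Md <-]] := monf_reduce _ _ e M_minor Me.
exact: mspanD.
Qed.

End PrimeField.

(** * Detecting the degree of a product of distinct variables *)

(** The coefficient of [x] in a polynomial of degree below [#|F|] is a linear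
    combination of its values: the weights form a column of the inverse
    of the Vandermonde matrix at all the points of the field. *)
Lemma evaluation_weights (F : finFieldType) :
  exists w : F -> F,
    forall k, (k < #|F|)%N -> \sum_a w a * a ^+ k = (k == 1%N)%:R.
Proof.
pose x : 'rV[F]_#|F| := \row_j enum_val j.
have V_unit : Vandermonde #|F| x \in unitmx.
  rewrite unitmxE det_Vandermonde unitfE.
  apply/prodf_neq0 => i _; apply/prodf_neq0 => j ij.
  rewrite !mxE subr_eq0; apply: contraTneq ij => /enum_val_inj ->.
  by rewrite ltnn.
have F_gt1 : (1 < #|F|)%N by apply: finNzRing_gt1.
exists (fun a => invmx (Vandermonde #|F| x) (enum_rank a) (Ordinal F_gt1)).
move=> k k_lt.
have /matrixP/(_ (Ordinal k_lt) (Ordinal F_gt1)) := mulmxV V_unit.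
rewrite !mxE -val_eqE /= => <-; rewrite big_enum_val /=.
by apply: eq_bigr => j _; rewrite !mxE enum_valK mulrC.
Qed.

(** Taking the weights of [evaluation_weights] in each variable gives a linear
    functional [T] that vanishes on all reduced monomials except the product of
    all the variables, where it is 1. So [T] does not vanish on that product,
    and some monomial with degree in [M] is that product. *)
Lemma multilinear_degree M n : prime p ->
    mspan (fun e : 'I_n -> nat =>
             (forall i, (e i <= p.-1)%N) /\ M (\sum_i e i)%N)
          (monf (fun=> 1%N)) ->
  M n.
Proof.
move=> p_prime; have p_gt0 := prime_gt0 p_prime.
have [w w_pick] := evaluation_weights 'F_p.
pose T (F : op 'F_p n) :=
  \sum_(v : {ffun 'I_n -> 'F_p}) (\prod_i w (v i)) * F v.
have T_mon e :
    (forall i, e i <= p.-1)%N -> T (monf e) = \prod_i (e i == 1%N)%:R.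
  move=> e_red; transitivity (\prod_i \sum_a w a * a ^+ e i); last first.
    apply: eq_bigr => i _; apply: w_pick.
    by rewrite card_Fp // -(prednK p_gt0) ltnS.
  rewrite bigA_distr_bigA; apply: eq_bigr => v _.
  by rewrite ffunE -big_split.
have : T (monf (fun=> 1%N)) != 0.
  by rewrite T_mon ?big1 ?oner_neq0 // => _; rewrite -ltnS prednK ?prime_gt1.
move: (monf _) => G T_G MG; elim: MG T_G => [|c e {}G [e_red Me] _ IH].
  by rewrite /T big1 ?eqxx // => v _; rewrite ffunE mulr0.
have -> : T [ffun v => c * monf e v + G v] = c * T (monf e) + T G.
  rewrite /T mulr_sumr -big_split /=; apply: eq_bigr => v _.
  by rewrite !ffunE mulrDr mulrCA.
have [/forallP e1|/forallPn[i /negPf ei]] := boolP [forall i, e i == 1%N].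
  move: Me; rewrite (eq_bigr (fun=> 1%N)) ?sum1_card ?card_ord //.
  by move=> i _; apply/eqP.
by rewrite T_mon // (bigD1 i) //= ei mul0r mulr0 add0r.
Qed.

(** * Iterative algebras and insertion *)

(** The composition used is [x_1 ... x_a y] with [y] replaced by the product
    of [b] further variables. If [a + b = 0] there is no variable to use, as
    arities are positive, but then the degree reached is [b] itself. *)
Lemma insertion_closed_composition M : prime p -> minor_subset p M ->
    opsub (opprod (@clonoid_of p M)
                  (opcup (@clonoid_of p M) (@projections 'F_p)))
          (@clonoid_of p M) ->
  insertion_closed M.
Proof.
move=> p_prime M_minor closed [//|a] b _ Ma Mb /=.
case N_def: (a + b)%N => [|N]; first by have -> : 0%N = b by lia.
have le_aN : (a <= N.+1)%N by lia.
pose block : op 'F_p N.+1 := monf (fun j => ~~ (j < a)%N : nat).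
pose g (i : 'I_a.+1) : op 'F_p N.+1 :=
  if (i < a)%N then proj 'F_p (inord i) else block.
have split_ord (R : Type) (idx : R) (o : Monoid.com_law idx) G :
    \big[o/idx]_j G j = o (\big[o/idx]_(i < a) G (inord i))
                          (\big[o/idx]_(j < N.+1 | ~~ (j < a)%N) G j).
  rewrite (bigID (fun j : 'I_N.+1 => (j < a)%N)) /=; congr (o _ _).
  rewrite (big_ord_narrow le_aN); apply: eq_bigr => i _; congr G.
  by apply: val_inj; rewrite /= inordK // (leq_trans (ltn_ord i)).
have block_deg : (\sum_(j < N.+1) ~~ (j < a) = b)%N.
  apply: (@addnI a); rewrite N_def -[N.+1 in RHS]card_ord -sum1_card.
  rewrite [RHS]split_ord /= sum1_card card_ord; congr (_ + _)%N.
  by rewrite [RHS]big_mkcond; apply: eq_bigr => j _; case: ifP.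
apply: (multilinear_degree _ _ p_prime); apply/clonoid_of_mspan/closed.
exists a, (monf (fun=> 1%N)), g; split.
- apply/clonoid_of_degspan => //; apply: mspan_mon.
  by rewrite sum1_card card_ord.
- move=> i; rewrite /g; case: ifP => _; [by right; exists (inord i)|left].
  by apply/clonoid_of_degspan => //; apply: mspan_mon; rewrite block_deg.
apply/ffunP => v; rewrite !ffunE split_ord big_ord_recr /=.
congr (_ * _).
  by apply: eq_bigr => i _; rewrite ffunE /g /= ltn_ord ffunE.
rewrite ffunE /g /= ltnn ffunE expr1 big_mkcond.
by apply: eq_bigr => j _; case: ifP.
Qed.

(** A degree [r + d] is seen as [r] plus [d] ones, and the ones are replaced
    in turn by the summands; [r] accumulates the summands already treated. *)
Lemma insertion_closed_sum M r d n : insertion_closed M ->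
  M (r + d)%N -> sum_of (fun k => M k \/ k = 1%N) d n -> M (r + n)%N.
Proof.
move=> insM Mrd [s [sd Es ->]].
elim: s r d sd Es Mrd => [|x s IH] r d <- Es //=.
move=> Mr; rewrite addnA; apply: IH erefl _ _.
  by move=> k ks; apply: Es; rewrite inE ks orbT.
rewrite addnAC; have [Mx|->] := Es x (mem_head _ _); last first.
  by rewrite addn1 -addnS.
by have := insM _ _ _ Mr Mx; rewrite addnS; apply.
Qed.

Lemma opprodS (C C' D D' : opset 'F_p) :
  opsub C C' -> opsub D D' -> opsub (opprod C D) (opprod C' D').
Proof.
move=> CC DD m h [n [f [g [Cf Dg ->]]]].
by exists n, f, g; split=> // [|i]; [apply: CC | apply: DD].
Qed.

Lemma clonoid_of_algebraP M : prime p -> minor_subset p M ->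
  lin_closed_iterative_algebra (@clonoid_of p M) <-> insertion_closed M.
Proof.
move=> p_prime M_minor; split=> [[_ closed]|insM].
  exact: insertion_closed_composition.
have toC : opsub (degspan M) (@clonoid_of p M).
  by move=> n f /clonoid_of_degspan; apply.
have ofC : opsub (@clonoid_of p M) (degspan M).
  by move=> n f /clonoid_of_degspan; apply.
have lin1 D : D 1%N -> opsub (degspan (eq 1%N)) (degspan D).
  by move=> D1 n f; apply: mspanS => e <-.
pose E k := M k \/ k = 1%N.
have MME : opsub (opprod (@clonoid_of p M) (degspan E)) (@clonoid_of p M).
  move=> m h Eh; apply/toC/(degspan_comp M E); last first.
    by move: Eh; apply: opprodS.
  by move=> d n Md; apply: (insertion_closed_sum _ 0).
split; first split.
- by exists 0%N, [ffun=> 0]; left.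
- move=> m h Lh; apply/toC/(degspan_comp (eq 1%N) M); last first.
    by move: Lh; apply: opprodS => // n f; apply: lin_clone_linear.
  by move=> d n <- /sum_of1.
- move=> m h Lh; apply: MME; move: Lh.
  by apply: opprodS => // n f /lin_clone_linear; apply: lin1; right.
move=> m h Lh; apply: MME; move: Lh; apply: opprodS => // n f [/ofC|].
  by apply: mspanS => e Me; left.
by move/projections_linear; apply: lin1; right.
Qed.

End MonomialSpans.

(** * The classification *)

Theorem theorem4p2 (p : nat) (M : nat -> Prop)
    (p_prime : prime p) (M_minor : minor_subset p M) :
  lin_closed_iterative_algebra (@clonoid_of p M) <->
  (forall n : nat, M n -> n = 0 \/ n = 1) \/
  (forall n : nat, M n) \/
  (exists m : nat, [/\ 0 < m, m %| p.-1 &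
     forall n : nat, M n <-> exists t : nat, n = 1 + t * m]).
Proof.
have q_gt0 : 0 < p.-1 by rewrite -ltnS prednK ?prime_gt1 ?prime_gt0.
by rewrite clonoid_of_algebraP //; apply: insertion_closedP.
Qed.
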